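(* Let $k\ge d\ge 3$ be fixed and $n\ge 3k^5$. Suppose that $\mathcal{F}\subset\binom{[n]}{k}$ is a $(d,2k+d-3)$-conditionally intersecting family. Then $|\mathcal{F}|\le\binom{n-1}{k-1}$.
   Context: $[n]=\{1,\ldots,n\}$, and $\binom{[n]}{k}$ denotes the collection of all $k$-element subsets of $[n]$. A family $\mathcal{F}\subset\binom{[n]}{k}$ is called $(d,s)$-conditionally intersecting if there do not exist $d$ distinct sets $A_1,\ldots,A_d\in\mathcal{F}$ with $|A_1\cup\cdots\cup A_d|\le s$ and $A_1\cap\cdots\cap A_d=\emptyset$. *)

(* Defs.v *)
From mathcomp Require Import all_boot.

Set Implicit Arguments.
Unset Strict Implicit.
Unset Printing Implicit Defensive.

(* The ground set {1, ..., n} is modelled by 'I_n = {0, ..., n - 1}. *)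

Definition uniform (n k : nat) (F : {set {set 'I_n}}) : Prop :=
  forall A : {set 'I_n}, A \in F -> #|A| = k.

(* For d = 0 the intersection below is the whole ground set, by the
   convention for empty intersections. *)
Definition conditionally_intersecting (n d s : nat) (F : {set {set 'I_n}}) :
    Prop :=
  ~ exists A : 'I_d -> {set 'I_n},
      [/\ injective A,
          forall i, A i \in F,
          #|\bigcup_(i < d) A i| <= s &
          \bigcap_(i < d) A i = set0].

(* Main.v *)
(* Call [x] in [A] own when [A] is the only member of [F] containing [A :\ x].
   Every (k-1)-set is [A :\ x] for at most one own pair, so the sum of
   [#|own A|] is at most C(n, k-1).  If [#|own A| <= 1] and some [B] in [F]
   meets [A] in one point that is not own, then [A], [B] and d - 2 members of
   [F] at distance one from [A] violate the hypothesis ([meet1_own]); this is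
   the only use of it.  Let E_x be the family of those [A] with
   [#|own A| <= 1] having [x] as a non-own point.  Its members pairwise meet
   outside [x], and so do members of E_x and their neighbours; hence either
   |E_x| is of order C(n-3, k-3), or all members of E_x have the same own
   point ([thru_monochrome]).
   If each [A] with [#|own A| <= 1] lies in a small E_x, there are few such
   [A], and counting own pairs gives about C(n, k-1) / 2 members in all.
   Otherwise some [A0] has own point [p] and all other points monochrome of
   colour [p], and [F] is compared with the full star at [p].  With m the
   number of sets missing from that star, the members avoiding [p] have at
   most m own pairs altogether, and weighting them by 2 - #|own A| gives total
   weight at most m as well (points [x] are compared one at a time, in
   [weight_link]); so there are at most m of them. *)

Require Import Defs.
From mathcomp Require Import all_boot.
From mathcomp Require Import zify.

Set Implicit Arguments.
Unset Strict Implicit.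
Unset Printing Implicit Defensive.

(** * Binomial estimates *)

Lemma bin_addl_le a b j : 'C(a + b, j.+1) <= 'C(a, j.+1) + b * 'C((a + b).-1, j).
Proof.
elim: b => [|b IH]; first by rewrite addn0 mul0n addn0.
rewrite addnS binS /= mulSn.
have : b * 'C((a + b).-1, j) <= b * 'C(a + b, j).
  by rewrite leq_mul2l leq_bin2l ?orbT // leq_pred.
lia.
Qed.

(** By [bin_addl_le], C(n-k-1, k-2) falls short of C(n-2, k-2) by at most (k-1) C(n-3, k-3), and
    C(n-2, k-2) is (n-2)/(k-2) times C(n-3, k-3). *)
Lemma bin_link_bound n k : 3 <= k -> 3 * k ^ 5 <= n ->
  6 * (k.-1 ^ 2 * 'C(n - 3, k - 3)) <= 'C(n - k - 1, k - 2).
Proof.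
move=> k3 nk; have kE : k = (k - 3).+3 by lia.
move: (k - 3) kE => j kE; subst k => {k3}.
have nE : n = (n - j.+3 - 1) + j.+2 + 2.
  suff : j.+4.+2 <= n by lia.
  apply: leq_trans nk; rewrite !expnS expn0; nia.
have := bin_addl_le (n - j.+3 - 1) j.+2 j.
have -> : (n - j.+3 - 1 + j.+2).-1 = n - 3 by lia.
have -> : n - j.+3 - 1 + j.+2 = n - 2 by lia.
have -> : j.+3 - 2 = j.+1 by lia.
have := mul_bin_diag (n - 2) j.
have -> : (n - 2).-1 = n - 3 by lia.
move: 'C(n - 3, j) 'C(n - 2, j.+1) => u V uV H.
have E : j.+1 * (6 * j.+2 ^ 2 + j.+2) <= n - 2.
  suff : j.+1 * (6 * j.+2 ^ 2 + j.+2) + 2 <= 3 * j.+3 ^ 5 by lia.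
  rewrite !expnS !expn0; nia.
have {}E : u * (j.+1 * (6 * j.+2 ^ 2 + j.+2)) <= j.+1 * V.
  by rewrite -uV mulnC leq_mul2r E orbT.
have {}E : u * (6 * j.+2 ^ 2 + j.+2) <= V by rewrite -(leq_pmul2l (ltn0Sn j)); lia.
rewrite /=; lia.
Qed.

(** As C(n, k-1) = C(n-1, k-1) + C(n-1, k-2), it suffices that the first term and C(n-1, k-2) are
    each at most half of C(n-1, k-1). *)
Lemma bin_star_bound n k : 3 <= k -> 3 * k ^ 5 <= n ->
  6 * (k.-1 ^ 2 * 'C(n - 3, k - 3)) * n + 'C(n, k.-1) <= 2 * 'C(n.-1, k.-1).
Proof.
move=> k3 nk; have kE : k = (k - 3).+3 by lia.
move: (k - 3) kE => j kE; subst k => {k3}.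
have n6 : 3 * j.+2 + j.+4.+2 <= n.
  apply: leq_trans nk; rewrite !expnS expn0; nia.
have nE : n = (n - 3).+3 by lia.
have E : 12 * j.+1 * j.+2 ^ 3 <= n - 3.
  suff : 12 * j.+1 * j.+2 ^ 3 + 3 <= 3 * j.+3 ^ 5 by lia.
  rewrite !expnS !expn0; nia.
move: (n - 3) nE E n6 => a nE E n6; subst n => {nk} /=.
rewrite binS.
have := mul_bin_left a.+2 j.+1; have := mul_bin_diag a.+2 j.+1 => /=.
have := mul_bin_diag a.+1 j => /=.
move: 'C(a.+2, j.+2) 'C(a.+2, j.+1) 'C(a.+1, j.+1) 'C(a, j) => N V' V u e1 e2 e3.
have h1 : 2 * V' <= N.
  rewrite -(leq_pmul2l (ltn0Sn j.+1)) e3; nia.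
have h2 : 12 * (j.+2 ^ 2 * u) * a.+3 <= N.
  rewrite -(leq_pmul2l (ltn0Sn j.+1)) -e2 -(leq_pmul2l (ltn0Sn j)).
  have -> : j.+1 * (a.+2 * V) = a.+2 * a.+1 * u by rewrite mulnCA -e1 mulnA.
  have -> : j.+1 * (j.+2 * (12 * (j.+2 ^ 2 * u) * a.+3)) =
            12 * j.+1 * j.+2 ^ 3 * a.+3 * u by rewrite !expnS expn0; nia.
  rewrite leq_mul2r; apply/orP; right.
  apply: (leq_trans (n := a * a.+3)); first by rewrite leq_mul2r E orbT.
  nia.
lia.
Qed.

(** * Counting tools *)

Lemma double_count (I J : finType) (G : {set I}) (f : I -> {set J})
    (w : I -> nat) :
  \sum_x \sum_(i in G | x \in f i) w i = \sum_(i in G) #|f i| * w i.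
Proof.
rewrite (exchange_big_dep (mem G)) /=; last by move=> x i _ /andP[].
apply: eq_bigr => i iG; rewrite -sum_nat_const; apply: eq_bigl => x.
by rewrite iG.
Qed.

Lemma card_bigcup_le (I T : finType) (A : {set I}) (G : I -> {set T}) b :
  (forall i, i \in A -> #|G i| <= b) -> #|\bigcup_(i in A) G i| <= #|A| * b.
Proof.
move=> Gb; rewrite -sum_nat_const.
elim/big_ind2: _ => [|X m Y p Xm Yp|i /Gb//]; first by rewrite cards0.
by apply: leq_trans (leq_add Xm Yp); rewrite cardsU leq_subr.
Qed.

Lemma card_extensions (T : finType) (G : {set {set T}}) (D Y : {set T}) j :
    (forall B, B \in G ->
      [/\ D \subset B, #|B| = #|D| + j & B :\: D \subset Y]) ->
  #|G| <= 'C(#|Y|, j).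
Proof.
move=> GP; rewrite -cards_draws.
have injD : {in G &, injective (fun B : {set T} => B :\: D)}.
  move=> B C /GP[DB _ _] /GP[DC _ _] E.
  by rewrite -(setID B D) -(setID C D) E (setIidPr DB) (setIidPr DC).
rewrite -(card_in_imset injD) subset_leq_card //.
apply/subsetP => _ /imsetP[B /GP[DB cB BY] ->].
by rewrite inE BY cardsD (setIidPr DB) cB addKn eqxx.
Qed.

(** * Own points and twins *)

Section Family.

Variables (T : finType) (k : nat) (F : {set {set T}}).
Hypothesis uniF : forall A, A \in F -> #|A| = k.

Implicit Types (A B : {set T}) (x y : T).

(** The default value [A] signals that no other member contains [A :\ x]. *)
Definition twin A x :=
  odflt A [pick B in F | (B != A) && (A :\ x \subset B)].

(* The [x] such that no other member of [F] contains [A :\ x]. *)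
Definition own A := [set x in A | twin A x == A].

Lemma own_sub A : own A \subset A.
Proof. by apply/subsetP => x; rewrite inE => /andP[]. Qed.

Lemma own_unique A B x : x \in own A -> B \in F -> A :\ x \subset B -> B = A.
Proof.
rewrite inE /twin => /andP[_]; case: pickP => [C /and3P[_ /negPf CA _]|H].
  by rewrite /= CA.
by move=> _ BF sB; apply/eqP/negbNE/negP => BA; have := H B; rewrite BF BA sB.
Qed.

Lemma twin_mem A x : A \in F -> twin A x \in F.
Proof. by rewrite /twin; case: pickP => [C /and3P[]|]. Qed.

Lemma twin_sub A x : A :\ x \subset twin A x.
Proof. by rewrite /twin; case: pickP => [C /and3P[]|_] //=; apply: subD1set. Qed.

(** If the twin contained [x] it would contain [A], hence equal [A] by size, and [x] would be
    own. *)
Lemma twinI A x : A \in F -> x \in A -> x \notin own A ->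
  A :&: twin A x = A :\ x.
Proof.
move=> AF xA xW; apply/eqP; rewrite eqEsubset andbC.
rewrite subsetI subD1set twin_sub /= subsetD1 subsetIl /=.
apply: contra xW => /setIP[_ xt]; rewrite inE xA eq_sym eqEcard.
rewrite (uniF AF) (uniF (twin_mem x AF)) leqnn andbT; apply/subsetP => y yA.
have [->//|yx] := eqVneq y x; apply: (subsetP (twin_sub A x)).
by rewrite in_setD1 yx.
Qed.

Lemma notin_twin A x : A \in F -> x \in A -> x \notin own A -> x \notin twin A x.
Proof.
move=> AF xA xW; apply/negP => xt.
by have := setD11 x A; rewrite -(twinI AF xA xW) inE xA xt.
Qed.

(* If not, [A], [B] and [d - 2] twins [twin A z], one of them with [z = x],
   form a forbidden configuration: each twin adds one point to [A :|: B],
   and [A :&: B = [set x]] while [x \notin twin A x]. *)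
Lemma meet1_own d A B x :
    3 <= d -> d <= k ->
    ~ (exists A : 'I_d -> {set T},
        [/\ injective A, forall i, A i \in F,
            #|\bigcup_(i < d) A i| <= 2 * k + d - 3 &
            \bigcap_(i < d) A i = set0]) ->
    A \in F -> B \in F -> #|own A| <= 1 -> A :&: B = [set x] ->
  x \in own A.
Proof.
move=> d3 dk cF AF BF oA AB; apply/negP => /negP xW; apply: cF.
have [xA xB] : x \in A /\ x \in B by apply/setIP; rewrite AB set11.
have xS : x \in A :\: own A by rewrite inE xW xA.
(* These are d - 2 distinct non-own points; [A] has at least k - 1 of them. *)
pose s := x :: take (d - 3) (enum ((A :\: own A) :\ x)).
have cS : k.-1 <= #|A :\: own A|.
  by rewrite cardsD (setIidPr (own_sub A)) (uniF AF) -subn1 leq_sub2l.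
have s_size : size s = d - 2.
  rewrite /= size_takel; first lia.
  rewrite -cardE; move: cS; rewrite (cardsD1 x) xS add1n; lia.
have sS z : z \in s -> z \in A :\: own A.
  by rewrite inE => /orP[/eqP->//|/mem_take]; rewrite mem_enum => /setD1P[].
have s_uniq : uniq s.
  rewrite /= take_uniq ?enum_uniq // andbT.
  by apply/negP => /mem_take; rewrite mem_enum setD11.
have sP z : z \in s -> [/\ z \in A, z \notin own A & A :&: twin A z = A :\ z].
  by move=> /sS/setDP[zA zW]; split=> //; apply: twinI.
have BA : B != A.
  by apply/eqP => E; have := uniF AF; rewrite -(setIid A) -{2}E AB cards1; lia.
pose c := A :: B :: [seq twin A z | z <- s].
have c_size : size c = d.
  by rewrite /c /= size_map -[(size _).+1]/(size s) s_size; clear -d3; lia.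
have c_uniq : uniq c.
  (* [A] meets [B] in one point, but a twin in k - 1 >= 2 points. *)
  have Bt : B \notin [seq twin A z | z <- s].
    apply/mapP => -[z /sP[zA zW tz] E].
    by have := leq_trans d3 dk; rewrite -(uniF AF) (cardsD1 z A) -tz -E AB cards1 zA.
  have At : A \notin [seq twin A z | z <- s].
    apply/mapP => -[z /sP[zA zW tz] E].
    by have := setD11 z A; rewrite -tz -E setIid zA.
  rewrite /c cons_uniq in_cons negb_or eq_sym BA At cons_uniq Bt.
  rewrite map_inj_in_uniq //.
  move=> z w /sP[zA zW tz] /sP[wA wW tw] E.
  apply/eqP/negP => /negP zw.
  by have := setD11 z A; rewrite -tz E tw in_setD1 zw zA.
have cP i : i < d -> nth A c i \in c by move=> id; rewrite mem_nth // c_size.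
exists (fun i : 'I_d => nth A c i); split.
- move=> i j /eqP; rewrite nth_uniq ?c_size // => /eqP; exact: val_inj.
- move=> i; move: (cP i (ltn_ord i)); rewrite in_cons in_cons.
  case/or3P => [/eqP->//|/eqP->//|/mapP[z /sP[zA zW _] ->]].
  exact: twin_mem.
- have sU : \bigcup_(i < d) nth A c i \subset
      (A :|: B) :|: \bigcup_(z in [set z in s]) (twin A z :\: A).
    apply/bigcupsP => i _; move: (cP i (ltn_ord i)); rewrite in_cons in_cons.
    case/or3P => [/eqP->|/eqP->|/mapP[z zs ->]].
    + by rewrite -setUA subsetUl.
    + by rewrite -setUA subsetU // subsetUl orbT.
    + apply/subsetP => y yt; rewrite !in_setU.
      case yA: (y \in A) => //=; apply/orP; right.
      by apply/bigcupP; exists z; rewrite inE ?zs // yA yt.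
  apply: leq_trans (subset_leq_card sU) _.
  apply: leq_trans (_ : #|A :|: B| + #|[set z in s]| * 1 <= _).
    rewrite cardsU (leq_trans (leq_subr _ _)) // leq_add2l.
    apply: card_bigcup_le => z; rewrite inE => /sP[zA zW tz]; rewrite cardsD setIC tz.
    by rewrite (uniF (twin_mem z AF)) -(uniF AF) (cardsD1 z A) zA addnK.
  rewrite cardsU AB cards1 (uniF AF) (uniF BF) cardsE (card_uniqP s_uniq) s_size.
  by clear -d3 dk; lia.
- apply/setP => y; rewrite inE; apply/negP => /bigcapP H.
  have H' C : C \in c -> y \in C.
    move=> Cc; have id : index C c < d by rewrite -c_size index_mem.
    by have := H (Ordinal id) isT; rewrite /= nth_index.
  have : y \in A :&: B by rewrite inE !H' // !inE eqxx ?orbT.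
  rewrite AB => /set1P yx; subst y.
  have : x \in twin A x by apply: H'; rewrite !inE /= ?eqxx ?orbT.
  by apply/negP; apply: notin_twin.
Qed.

(** * Sets through a common non-own point *)

Hypothesis k3 : 3 <= k.
Hypothesis meet1 : forall A B x, A \in F -> B \in F -> #|own A| <= 1 ->
  A :&: B = [set x] -> x \in own A.

(** This is the family E_x. *)
Definition thru x := [set A in F | (#|own A| <= 1) && (x \in A :\: own A)].

Lemma thruP A x :
  reflect [/\ A \in F, #|own A| <= 1, x \in A & x \notin own A] (A \in thru x).
Proof.
have -> : (A \in thru x) = [&& A \in F, #|own A| <= 1, x \notin own A & x \in A].
  by rewrite [LHS]in_set in_setD.
by apply: (iffP and4P) => -[].
Qed.

Lemma thru_meet2 A B x : A \in thru x -> B \in F -> x \in B ->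
  exists y, [/\ y \in A, y \in B & y != x].
Proof.
case/thruP=> AF oA xA xW BF xB.
have /subsetPn[y /setIP[yA yB]] : ~~ (A :&: B \subset [set x]).
  apply: contra xW => ABx; apply: meet1 AF BF oA _.
  by apply/eqP; rewrite eqEsubset ABx sub1set inE xA.
by rewrite inE; exists y.
Qed.

(** The number of k-sets through three given points. *)
Definition nb3 := 'C(#|T| - 3, k - 3).

Lemma card_over3 x y z : x != y -> x != z -> y != z ->
  #|[set B in F | [&& x \in B, y \in B & z \in B]]| <= nb3.
Proof.
move=> xy xz yz.
have cD : #|[set x; y; z]| = 3.
  by rewrite -setUA !cardsU1 cards1 !inE negb_or xy xz yz.
have -> : nb3 = 'C(#|~: [set x; y; z]|, k - 3).
  by rewrite [in RHS]cardsCs setCK cD.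
apply: (@card_extensions _ _ [set x; y; z]) => B.
rewrite inE => /and4P[BF xB yB zB]; split; last by rewrite setDE subsetIr.
  by rewrite !subUset !sub1set xB yB zB.
by rewrite cD (uniF BF) subnKC.
Qed.

(* [B] meets [A] in some [y != x], which is not own in [A], and then meets
   [twin A y], which avoids [y], in some [z != x]. *)
Lemma thru_avoid A x : A \in thru x ->
  #|[set B in thru x | [disjoint B & own A]]| <= k.-1 ^ 2 * nb3.
Proof.
move=> Ax; have [AF oA xA xW] := thruP _ _ Ax.
pose G y z := [set B in F | [&& x \in B, y \in B & z \in B]].
have cA : #|A :\ x| = k.-1 by rewrite -(uniF AF) (cardsD1 x A) xA.
apply: (leq_trans (n := #|\bigcup_(y in A :\ x)
                           \bigcup_(z in twin A y :\ x :\ y) G y z|)).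
  apply/subset_leq_card/subsetP => B; rewrite inE => /andP[Bx dB].
  have [BF _ xB _] := thruP _ _ Bx.
  have [y [yA yB yx]] := thru_meet2 Ax BF xB.
  have yW := disjointFr dB yB.
  have xt : x \in twin A y.
    by apply: (subsetP (twin_sub A y)); rewrite in_setD1 eq_sym yx.
  have [z [zB zt zx]] := thru_meet2 Bx (twin_mem y AF) xt.
  apply/bigcupP; exists y; first by rewrite !inE yx.
  apply/bigcupP; exists z; last by rewrite inE BF xB yB zB.
  rewrite !inE zx zt; case: eqP => // zy; subst z.
  by rewrite (negPf (notin_twin AF yA _)) ?yW in zt.
rewrite expnS expn1 -mulnA -[X in _ <= X * _]cA; apply: card_bigcup_le => y.
rewrite in_setD1 => /andP[yx yA].
have xt : x \in twin A y.
  by apply: (subsetP (twin_sub A y)); rewrite in_setD1 eq_sym yx.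
apply: (leq_trans (n := #|twin A y :\ x :\ y| * nb3)).
  apply: card_bigcup_le => z; rewrite !in_setD1 => /and3P[zy zx _].
  by apply: card_over3; rewrite eq_sym.
rewrite leq_mul2r; apply/orP; right.
rewrite -(uniF (twin_mem y AF)) [X in _ <= X.-1](cardsD1 x) xt.
by rewrite subset_leq_card ?subD1set.
Qed.

(** If some [A] has no own point, [thru_avoid] bounds all of [thru x]. If two members have own
    points [q] and [r], distinct, every member avoids [q], avoids [r], or contains [x], [q] and [r];
    each case accounts for at most [k.-1 ^ 2 * nb3] sets. *)
Lemma thru_monochrome x : 3 * (k.-1 ^ 2 * nb3) < #|thru x| ->
  exists q, forall A, A \in thru x -> own A = [set q].
Proof.
move=> big.
have oneP A : A \in thru x -> exists q, own A = [set q].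
  move=> Ax; apply/cards1P; rewrite eqn_leq.
  have [_ -> _ _] := thruP _ _ Ax; rewrite lt0n cards_eq0.
  apply/eqP => W0; have := thru_avoid Ax.
  have -> : [set B in thru x | [disjoint B & own A]] = thru x.
    by apply/setP => B; rewrite inE W0 disjoints_subset setC0 subsetT andbT.
  by rewrite leqNgt (leq_ltn_trans _ big) // leq_pmull.
have /card_gt0P[A Ax] : 0 < #|thru x| by apply: leq_ltn_trans big.
have [q Aq] := oneP A Ax; exists q => B Bx.
have [r Br] := oneP B Bx; have [<-//|rq] := eqVneq r q.
have qx : x != q.
  by have [_ _ _] := thruP _ _ Ax; rewrite Aq inE.
have rx : x != r.
  by have [_ _ _] := thruP _ _ Bx; rewrite Br inE.
have := big; rewrite ltnNge => /negP[].
have sub : thru x \subset [set C in thru x | [disjoint C & own A]]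
   :|: [set C in thru x | [disjoint C & own B]]
   :|: [set C in F | [&& x \in C, q \in C & r \in C]].
  apply/subsetP => C Cx; have [CF _ xC _] := thruP _ _ Cx.
  apply/setUP; case qC: (q \in C); first case rC: (r \in C).
  - by right; rewrite inE CF xC qC rC.
  - by left; apply/setUP; right; rewrite inE Cx Br disjoint_sym disjoints1 rC.
  - by left; apply/setUP; left; rewrite inE Cx Aq disjoint_sym disjoints1 qC.
have nb3_le : nb3 <= k.-1 ^ 2 * nb3.
  by rewrite leq_pmull // expn_gt0; case: (k) k3 => [|[]].
apply: leq_trans (subset_leq_card sub) _.
rewrite (leq_trans (leq_card_setU _ _)) // mulSn addnC.
rewrite (leq_add (leq_trans (card_over3 qx rx _) nb3_le)) //; first by rewrite eq_sym.
rewrite (leq_trans (leq_card_setU _ _)) // mulSn mul1n.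
by rewrite leq_add ?thru_avoid.
Qed.

(** Sending an own pair [(A, x)] to [A :\ x] is injective by [own_unique]. *)
Lemma own_sum (G Y : {set {set T}}) : G \subset F ->
    (forall A x, A \in G -> x \in own A -> A :\ x \in Y) ->
  \sum_(A in G) #|own A| <= #|Y|.
Proof.
move=> /subsetP GF GY.
pose Q := [set u : {set T} * T | (u.1 \in G) && (u.2 \in own u.1)].
have inQ u : (u \in Q) = (u.1 \in G) && (u.2 \in own u.1) by rewrite [LHS]in_set.
have -> : \sum_(A in G) #|own A| = #|Q|.
  under eq_bigr do rewrite -sum1_card.
  rewrite pair_big_dep /= -sum1_card.
  by apply: eq_bigl => u; rewrite inQ.
have injQ : {in Q &, injective (fun u : {set T} * T => u.1 :\ u.2)}.
  move=> [A x] [B y]; rewrite !inQ /= => /andP[AG xA] /andP[BG yB] E.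
  have AB : B = A by apply: own_unique xA (GF _ BG) _; rewrite E subD1set.
  rewrite AB in E *; congr (_, _); apply/eqP/negbNE/negP => xy.
  have := setD11 x A; rewrite E in_setD1 xy.
  by rewrite (subsetP (own_sub A)).
rewrite -(card_in_imset injQ); apply/subset_leq_card/subsetP => S.
move=> /imsetP[u uQ ->].
by move: uQ; rewrite inQ => /andP[]; apply: GY.
Qed.

Hypothesis link_bound : 6 * (k.-1 ^ 2 * nb3) <= 'C(#|T| - k - 1, k - 2).

(** * Comparison with the full star at [p] *)

Section Center.

Variables (p : T) (A0 : {set T}).
Hypothesis A0F : A0 \in F.
Hypothesis A0mono : forall x A,
  x \in A0 :\ p -> A \in thru x -> own A = [set p].

(** The k-sets missing from the star, with [p] removed so that they compare with the sets
    [A :\ x]. *)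
Definition missing :=
  [set S : {set T} | [&& p \notin S, #|S| == k.-1 & p |: S \notin F]].

Lemma card_off_p (B : {set T}) : #|B| = k -> p \notin B ->
  #|~: (p |: B)| = #|T| - k - 1.
Proof.
by move=> cB pB; rewrite [LHS]cardsCs setCK cardsU1 pB cB addnC subnDA.
Qed.

(* A set containing [p] and meeting [B] only in [x] is not in [F]. *)
Lemma missing_link x B : B \in thru x -> p \notin B ->
  'C(#|T| - k - 1, k - 2) <= #|[set S in missing | x \in S]|.
Proof.
move=> Bx pB; have [BF oB xB xW] := thruP _ _ Bx.
rewrite -(card_off_p (uniF BF) pB) -cards_draws.
(* Each such [S] gives the missing set [x |: S]: with [p] added, it meets [B] only in [x]. *)
set D := [set S : {set T} | _].
have DP S : S \in D -> [/\ [disjoint S & B], p \notin S & #|S| = k - 2].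
  rewrite inE setCU subsetI => /andP[/andP[pS SB] /eqP cS].
  by rewrite disjoints_subset; split=> //; rewrite subsetC sub1set inE in pS.
have xS S : S \in D -> x \notin S by move=> /DP[dS _ _]; rewrite (disjointFl dS).
have injx : {in D &, injective (fun S : {set T} => x |: S)}.
  by move=> S U /xS xS' /xS xU E; rewrite -(setU1K xS') E setU1K.
rewrite -(card_in_imset injx); apply/subset_leq_card/subsetP => U.
move=> /imsetP[S SD ->{U}]; have [dS pS cS] := DP S SD.
rewrite !inE eqxx andbT negb_or pS cardsU1 xS // cS.
have -> : p != x by apply: contraNneq pB => ->.
have -> : (true + (k - 2) == k.-1) by case: (k) k3 => [|[|j]] // _; rewrite !subSS subn0.
apply: contra xW => SF; apply: meet1 BF SF oB _.
apply/setP => y; rewrite !inE; have [->|yx] := eqVneq y x.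
  by rewrite xB orbT.
case yB: (y \in B) => //=; rewrite (disjointFl dS yB) orbF.
by apply: contraNF pB => /eqP <-.
Qed.

(** The members avoiding [p] whose weight [2 - #|own A|] is positive. *)
Definition off := [set A in F | (#|own A| <= 1) && (p \notin A)].

Lemma off_thru x A : (A \in off) && (x \in A :\: own A) =
  (A \in thru x) && (p \notin A).
Proof.
rewrite [A \in off]in_set [A \in thru x]in_set.
by case: (A \in F) (_ <= 1) (_ \in _ :\: _) (_ \in A) => -[] [] [].
Qed.

(* When E_x is monochrome of colour [q], its members avoiding [p] contain
   [q] and [x] and, [q] aside, avoid [p |: A0], so they are at most as many
   as the missing sets given by [missing_link]. *)
Lemma weight_link x :
  \sum_(A in off | x \in A :\: own A) (2 - #|own A|) <=
  #|[set S in missing | x \in S]|.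
Proof.
under eq_bigl do rewrite off_thru.
have [A AX|none] := pickP [pred A | (A \in thru x) && (p \notin A)]; last first.
  by rewrite big_pred0.
have /andP[Ax pA] := AX.
apply: leq_trans (missing_link Ax pA).
have [small|big] := leqP #|thru x| (3 * (k.-1 ^ 2 * nb3)).
  (* Weights are at most 2, whence the factor 6 = 2 * 3 in [link_bound]. *)
  apply: leq_trans link_bound.
  apply: (leq_trans (n := \sum_(B in thru x) 2)).
    rewrite big_mkcondr; apply: leq_sum => B _.
    by case: ifP => _ //; apply: leq_subr.
  by rewrite sum_nat_const mulnC -[6]/(2 * 3) -mulnA leq_mul2l.
have [q Eq] := thru_monochrome big.
have qp : q != p.
  apply: contraNneq pA => <-; have /thruP[_ _ _ _] := Ax.
  by rewrite (subsetP (own_sub A)) // (Eq _ Ax) set11.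
(* A [y] in [A0] would be non-own in [B], so [A0mono] would make [p], not [q], the own point of
   [B]. *)
have offA0 y B : B \in thru x -> p \notin B -> y \in B -> y != q -> y \notin A0.
  move=> Bx pB yB yq; apply/negP => yA0.
  have [BF oB xB _] := thruP _ _ Bx.
  have yp : y != p by apply: contraNneq pB => <-.
  have By : B \in thru y by apply/thruP; split; rewrite // (Eq _ Bx) inE.
  have /setP/(_ q) : own B = [set p] by apply: A0mono By; rewrite in_setD1 yp.
  by rewrite (Eq _ Bx) !inE eqxx (negPf qp).
have xq : x != q by have /thruP[_ _ _] := Ax; rewrite (Eq _ Ax) inE.
have xA0 : x \notin A0 by apply: (offA0 _ A) => //; case/thruP: Ax.
have cY : #|~: (x |: A0)| = #|T| - k - 1.
  by rewrite [LHS]cardsCs setCK cardsU1 xA0 (uniF A0F) addnC subnDA.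
rewrite (eq_bigr (fun=> 1)); last first.
  by move=> B /andP[/Eq -> _]; rewrite cards1.
rewrite sum1dep_card -cY; apply: (@card_extensions _ _ [set q; x]) => B.
rewrite in_set => /andP[Bx pB]; have [BF oB xB _] := thruP _ _ Bx.
have qB : q \in B by rewrite (subsetP (own_sub B)) // (Eq _ Bx) set11.
split.
- by rewrite subUset !sub1set qB xB.
- by rewrite cards2 eq_sym xq (uniF BF) subnKC // ltnW.
- apply/subsetP => y; rewrite !inE !negb_or => /andP[/andP[yq yx] yB].
  by rewrite yx; apply: (offA0 y B).
Qed.

(** Summing [weight_link] over [x] counts each set of [off] at least k - 1 times and each missing
    set exactly k - 1 times. *)
Lemma weight_sum : \sum_(A in F | p \notin A) (2 - #|own A|) <= #|missing|.
Proof.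
have k1 : 0 < k.-1 by case: (k) k3 => [|[]].
rewrite -(leq_pmul2l k1).
apply: (leq_trans (n := \sum_(A in off) #|A :\: own A| * (2 - #|own A|))).
  rewrite big_distrr /= [X in X <= _](bigID (fun A => #|own A| <= 1)) /=.
  rewrite [X in _ + X]big1 ?addn0; last first.
    move=> A /andP[_]; rewrite -ltnNge -subn_eq0 => /eqP->; exact: muln0.
  rewrite [X in _ <= X](eq_bigl (fun A => (A \in F) && (p \notin A) && (#|own A| <= 1))).
    apply: leq_sum => A /andP[/andP[AF _] oA]; rewrite leq_mul2r.
    by rewrite cardsD (setIidPr (own_sub A)) (uniF AF) -subn1 leq_sub2l ?orbT.
  by move=> A; rewrite [LHS]in_set andbA andbAC.
rewrite -(double_count off (fun A => A :\: own A)).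
apply: (leq_trans (n := \sum_x #|[set S in missing | x \in S]|)).
  by apply: leq_sum => x _; apply: weight_link.
have -> : \sum_x #|[set S in missing | x \in S]| =
          \sum_x \sum_(S in missing | x \in S) 1.
  by apply: eq_bigr => x _; rewrite sum1dep_card.
rewrite (double_count missing (fun S => S)) mulnC -sum_nat_const.
by apply: leq_sum => S; rewrite inE muln1 => /and3P[_ /eqP-> _].
Qed.

(** If [x] is own in [A] and [p] is not in [A], then [A :\ x] is missing: adding [p] to it gives a
    set other than [A]. *)
Lemma off_own_sum : \sum_(A in F | p \notin A) #|own A| <= #|missing|.
Proof.
rewrite (eq_bigl (mem [set A in F | p \notin A])); last first.
  by move=> A; rewrite /= in_set.
apply: own_sum => [|A x]; first by apply/subsetP => A; rewrite in_set => /andP[].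
rewrite in_set => /andP[AF pA] xo; have xA := subsetP (own_sub A) _ xo.
rewrite inE in_setD1 negb_and pA orbT -(uniF AF) [X in _ == X.-1](cardsD1 x) xA.
rewrite eqxx /=; apply: contra pA => sF.
by rewrite -(own_unique xo sF (subsetUr _ _)) setU11.
Qed.

Lemma star_card : #|[set A in F | p \in A]| + #|missing| <= 'C(#|T|.-1, k.-1).
Proof.
have injp : {in [set A in F | p \in A] &, injective (fun A : {set T} => A :\ p)}.
  move=> A B; rewrite !inE => /andP[_ pA] /andP[_ pB] E.
  by rewrite -(setD1K pA) E setD1K.
have -> : #|T|.-1 = #|~: [set p]| by rewrite [RHS]cardsCs setCK cards1 subn1.
rewrite -(card_in_imset injp) -cards_draws -cardsUI.
have -> : [set A :\ p | A in [set A in F | p \in A]] :&: missing = set0.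
  apply/setP => S; rewrite in_set0; apply/negP => /setIP[/imsetP[A]].
  by rewrite !inE => /andP[AF pA] ->; rewrite setD1K // AF !andbF.
rewrite cards0 addn0; apply/subset_leq_card/subsetP => S /setUP[/imsetP[A]|].
  rewrite !inE => /andP[AF pA] ->.
  by rewrite subsetC sub1set inE setD11 -(uniF AF) (cardsD1 p A) pA eqxx.
by rewrite !inE subsetC sub1set inE => /and3P[-> -> _].
Qed.

Lemma center_bound : #|F| <= 'C(#|T|.-1, k.-1).
Proof.
apply: leq_trans star_card.
rewrite -(cardsID [set A : {set T} | p \in A] F).
have -> : F :&: [set A : {set T} | p \in A] = [set A in F | p \in A].
  by apply/setP => A; rewrite !inE.
rewrite leq_add2l -(leq_pmul2l (isT : 0 < 2)) [X in _ <= X]mul2n -addnn.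
apply: leq_trans (leq_add weight_sum off_own_sum).
rewrite -big_split /= mulnC -sum_nat_const.
rewrite [X in _ <= X](eq_bigl (mem (F :\: [set A : {set T} | p \in A]))).
  by apply: leq_sum => A _; rewrite addnC -leq_subLR.
by move=> A; rewrite !inE andbC.
Qed.

End Center.

(** * Finding a center, or counting own pairs directly *)

Hypothesis star_bound :
  6 * (k.-1 ^ 2 * nb3) * #|T| + 'C(#|T|, k.-1) <= 2 * 'C(#|T|.-1, k.-1).

Lemma family_bound : #|F| <= 'C(#|T|.-1, k.-1).
Proof.
pose R := [set A in F | #|own A| <= 1].
pose poor := [set x | #|thru x| <= 3 * (k.-1 ^ 2 * nb3)].
have inR A : (A \in R) = (A \in F) && (#|own A| <= 1) by rewrite [LHS]in_set.
have own1 A x : #|own A| <= 1 -> x \in own A -> own A = [set x].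
  by move=> oA xo; apply/eqP; rewrite eq_sym eqEcard sub1set xo cards1.
have [A0 /andP[A0R noP]|allP] :=
  pickP [pred A | (A \in R) && ~~ [exists x in A :\: own A, x \in poor]].
  have /andP[A0F oA0] : (A0 \in F) && (#|own A0| <= 1) by rewrite -inR.
  have rich x : x \in A0 :\: own A0 -> A0 \in thru x /\
      exists q, forall A, A \in thru x -> own A = [set q].
    move=> xA; split.
      by apply/thruP; move: xA; rewrite in_setD => /andP[].
    apply: thru_monochrome; rewrite ltnNge; apply: contra noP => h.
    by apply/exists_inP; exists x; rewrite // inE.
  have /card_gt0P[x0 /rich[A0x0 [p Ep]]] : 0 < #|A0 :\: own A0|.
    rewrite cardsD (setIidPr (own_sub A0)) (uniF A0F) subn_gt0.
    exact: leq_ltn_trans oA0 (ltnW k3).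
  (* [A0] lies in [thru x] for each of its non-own points [x], so all these families share its own
     point [p] as color. *)
  have oA0p := Ep _ A0x0; apply: (@center_bound p A0) => // x A.
  rewrite -oA0p => /rich[A0x [q Eq]] Ax.
  by rewrite (Eq _ Ax) -(Eq _ A0x).
have cR : #|R| <= #|T| * (3 * (k.-1 ^ 2 * nb3)).
  apply: (leq_trans (n := #|\bigcup_(x in poor) thru x|)).
    apply/subset_leq_card/subsetP => A AR.
    have := allP A; rewrite /= AR => /negbFE/exists_inP[x xA xp].
    apply/bigcupP; exists x => //; move: AR xA.
    by rewrite inR in_setD => /andP[? ?] /andP[? ?]; apply/thruP.
  apply: leq_trans (card_bigcup_le _) _.
    by move=> x; rewrite inE => h; exact: h.
  by rewrite leq_mul2r max_card orbT.
have cown : \sum_(A in F) #|own A| <= 'C(#|T|, k.-1).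
  rewrite -cardsT -cards_draws; apply: own_sum => // A x AF xo.
  rewrite inE subsetT -(uniF AF) [X in _ == X.-1](cardsD1 x).
  by rewrite (subsetP (own_sub A) _ xo) eqxx.
rewrite -(leq_pmul2l (isT : 0 < 2)); apply: leq_trans star_bound.
(* Members outside [R] have at least two own points. *)
apply: (leq_trans (n := 2 * #|R| + \sum_(A in F) #|own A|)); last first.
  apply: leq_add cown; apply: leq_trans (_ : 2 * (#|T| * (3 * (k.-1 ^ 2 * nb3))) <= _).
    by rewrite leq_mul2l cR.
  by rewrite -[6]/(2 * 3) -(mulnA 2 3) -(mulnA 2) leq_mul2l /= mulnC.
rewrite mulnC -sum_nat_const mulnC -sum_nat_const.
rewrite (eq_bigl _ _ inR) big_mkcondr -big_split /=.
by apply: leq_sum => A _; case: ifP => // /negbT; rewrite -ltnNge.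
Qed.

End Family.

Theorem theorem1p8 (k d n : nat) (F : {set {set 'I_n}}) :
  3 <= d -> d <= k -> 3 * k ^ 5 <= n ->
  uniform k F ->
  conditionally_intersecting d (2 * k + d - 3) F ->
  #|F| <= 'C(n.-1, k.-1).
Proof.
move=> d3 dk kn uF cF; have k3 := leq_trans d3 dk.
rewrite -[n in X in _ <= X]card_ord; apply: (@family_bound _ k) => //.
- by move=> A B x; apply: meet1_own d3 dk cF.
- by rewrite /nb3 card_ord; apply: bin_link_bound.
- by rewrite /nb3 card_ord; apply: bin_star_bound.
Qed.
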